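(* Consider the uplink model described in the context with maximum ratio combining, i.e. $\mathbf{c}_k=\Phi\mathbf{D}\hat{\mathbf{h}}_k$ for each $k\in\{1,\dots,K\}$. Then for every $k$, the uplink achievable rate satisfies $$R^U_k \ \ge\ \underline{R}^{\mathrm{MRC},U}_k=\frac{T_U}{T}\log_2\!\big(1+\mathrm{SINR}^{\mathrm{MRC},U}_k\big),$$ where $$\mathrm{SINR}^{\mathrm{MRC},U}_k=\frac{M\,p^d_k\,\rho\,\tau\,p^p_k\,\beta_k^2\,|\Phi|^2}{\Big(\sum_{k'=1}^K p^d_{k'}\beta_{k'}+\frac{\sigma^2}{|\Phi|^2\rho}\Big)\big(\rho\,\tau\,p^p_k\,\beta_k\,|\Phi|^2+\sigma^2\big)}.$$
   Context: Let $M,K,T$ be positive integers, $\tau=K$, and $T_U\ge 0$ an integer. Let $\Phi\in\mathbb{C}\setminus\{0\}$, $\rho>0$, $\sigma^2>0$, and let $\mathbf{D}\in\mathbb{C}^{M\times M}$ be a diagonal matrix whose diagonal entries have unit modulus (so $\mathbf{D}^H\mathbf{D}=\mathbf{I}_M$). For $k=1,\dots,K$ let $\beta_k>0$, pilot powers $p^p_k>0$ and data powers $p^d_k\ge 0$. The channels $\mathbf{h}_k\sim\mathcal{CN}(\mathbf{0},\beta_k\mathbf{I}_M)$, $k=1,\dots,K$, are mutually independent. The received pilot observation for device $k$ is $\mathbf{y}_k=\sqrt{\rho\tau p^p_k}\,\Phi\mathbf{D}\mathbf{h}_k+\mathbf{z}_k$, where $\mathbf{z}_k\sim\mathcal{CN}(\mathbf{0},\sigma^2\mathbf{I}_M)$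 are mutually independent and independent of the channels. The MMSE channel estimate is $$\hat{\mathbf{h}}_k=\frac{\rho\beta_k\tau p^p_k|\Phi|^2}{\rho\beta_k\tau p^p_k|\Phi|^2+\sigma^2}\mathbf{h}_k+\frac{\sqrt{\rho\tau p^p_k}\,\beta_k\Phi^*}{\rho\beta_k\tau p^p_k|\Phi|^2+\sigma^2}\mathbf{D}^H\mathbf{z}_k .$$ In the uplink data phase, $\mathbf{n}\sim\mathcal{CN}(\mathbf{0},\sigma^2\mathbf{I}_M)$ is noise independent of everything else, and $\mathbf{c}_k\in\mathbb{C}^M$ is the combining vector for device $k$. Define (all expectations over channels, pilot noise and data noise) $\mathrm{Ds}_k=\mathbb{E}\{\sqrt{\rho p^d_k}\,\Phi\,\mathbf{c}_k^H\mathbf{D}\mathbf{h}_k\}$, $|\mathrm{Ls}_k|^2=\mathbb{E}\{|\sqrt{\rho p^d_k}\,\Phi\,\mathbf{c}_k^H\mathbf{D}\mathbf{h}_k|^2\}-|\mathrm{Ds}_k|^2$, $|\mathrm{UI}_{k,k'}|^2=\mathbb{E}\{|\sqrt{\rho p^d_{k'}}\,\Phi\,\mathbf{c}_k^H\mathbf{D}\mathbf{h}_{k'}|^2\}$ for $k'\ne k$, $|\mathrm{N}_k|^2=\mathbb{E}\{|\mathbf{c}_k^H\mathbf{n}|^2\}$, and the uplink achievable rate $$R^U_k=\frac{T_U}{T}\log_2\!\Big(1+\frac{|\mathrm{Ds}_k|^2}{|\mathrm{Ls}_k|^2+\sum_{k'\neq k}|\mathrm{UI}_{k,k'}|^2+|\mathrm{N}_k|^2}\Big).$$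 *)

(* Defs.v *)
From HB Require Import structures.
From mathcomp Require Import all_boot all_order all_algebra.
From mathcomp Require Import all_classical all_reals all_analysis.
From mathcomp Require Import complex.
Set Implicit Arguments. Unset Strict Implicit. Unset Printing Implicit Defensive.
Import Order.TTheory GRing.Theory Num.Theory.
Local Open Scope classical_set_scope.
Local Open Scope ring_scope.

Definition sqmod (R : realType) (z : R[i]) : R := complex.Re z ^+ 2 + complex.Im z ^+ 2.

Definition hermT (R : realType) m n (A : 'M[R[i]]_(m, n)) : 'M[R[i]]_(n, m) :=
  \matrix_(i, j) conjc (A j i).

Definition cinner (R : realType) M (c x : 'cV[R[i]]_M) : R[i] :=
  (hermT c *m x) 0 0.

Definition Ereal d (T : measurableType d) (R : realType) (P : probability T R)
  (X : T -> R) : R := fine ('E_P[X])%E.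

Definition Ecplx d (T : measurableType d) (R : realType) (P : probability T R)
  (X : T -> R[i]) : R[i] :=
  Complex (Ereal P (fun w => complex.Re (X w))) (Ereal P (fun w => complex.Im (X w))).

Definition mutually_independent d (T : measurableType d) (R : realType)
  (P : probability T R) (I : finType) (g : I -> {RV P >-> R}) : Prop :=
  forall B : I -> set R, (forall i, measurable (B i)) ->
    P [set w | forall i, B i (g i w)] = (\prod_(i : I) P (g i @^-1` B i))%E.

Definition std_normal d (T : measurableType d) (R : realType)
  (P : probability T R) (X : {RV P >-> R}) : Prop :=
  forall A : set R, measurable A -> P (X @^-1` A) = normal_prob 0 1 A.

(* Index set for the underlying real Gaussian coordinates:
   inl (inl (k,m)) : entry m of channel h_k,
   inl (inr (k,m)) : entry m of pilot noise z_k,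
   inr m           : entry m of data noise n;
   the boolean selects the real (true) or imaginary (false) part. *)
Definition gidx (K M : nat) : finType :=
  (((('I_K * 'I_M) + ('I_K * 'I_M)) + 'I_M) * bool)%type.

(* circularly-symmetric complex Gaussian entry CN(0, v) built from two
   independent N(0,1) real coordinates: sqrt(v/2) (a + i b) *)
Definition cgauss (R : realType) (v a b : R) : R[i] :=
  Complex (Num.sqrt (v / 2) * a) (Num.sqrt (v / 2) * b).


Definition chan d (T : measurableType d) (R : realType) (P : probability T R)
  (K M : nat) (g : gidx K M -> {RV P >-> R}) (beta : 'I_K -> R) (k : 'I_K)
  (w : T) : 'cV[R[i]]_M :=
  \col_m cgauss (beta k) (g (inl (inl (k, m)), true) w)
                         (g (inl (inl (k, m)), false) w).

Definition pnoise d (T : measurableType d) (R : realType) (P : probability T R)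
  (K M : nat) (g : gidx K M -> {RV P >-> R}) (sigma2 : R) (k : 'I_K)
  (w : T) : 'cV[R[i]]_M :=
  \col_m cgauss sigma2 (g (inl (inr (k, m)), true) w)
                       (g (inl (inr (k, m)), false) w).

Definition dnoise d (T : measurableType d) (R : realType) (P : probability T R)
  (K M : nat) (g : gidx K M -> {RV P >-> R}) (sigma2 : R)
  (w : T) : 'cV[R[i]]_M :=
  \col_m cgauss sigma2 (g (inr m, true) w) (g (inr m, false) w).

Definition log2 (R : realType) (x : R) : R := ln x / ln 2.

Definition toC (R : realType) (x : R) : R[i] := Complex x 0.

(* Main.v *)
(* With c_k = Phi D hhat_k and D^H D = 1, the bound is an equality. Every signal
   has the form X = sum_m conj(A_m) B_m, where the A_m (entries of hhat_k) and
   the B_m (scaled entries of h_k' or n) are linear forms in independent circular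
   complex Gaussians. Isserlis' theorem for four Gaussian factors, together with
   the vanishing of the pseudo-covariances, gives
     E|X|^2 = |E X|^2 + sum_(m,n) conj(E[A_m conj A_n]) E[B_m conj B_n],
   and both covariances are multiples of the identity. Hence the variance of the
   own signal, the interference powers and the noise power are all M gamma_k times
   an explicit constant, where gamma_k is the variance of an entry of hhat_k;
   gamma_k also equals the MMSE gain times beta_k, and the SINR follows. *)
Require Import Defs.
From HB Require Import structures.
From mathcomp Require Import all_boot all_order all_algebra.
From mathcomp Require Import all_classical all_reals all_analysis.
From mathcomp Require Import complex measurable_realfun ring lra.
Import Order.TTheory GRing.Theory Num.Theory.
Import numFieldNormedType.Exports.
Local Open Scope classical_set_scope.
Local Open Scope ring_scope.

(** * Independence and expectations of products *)

Section Decoupling.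
Context d d' (T : measurableType d) (T' : measurableType d') (R : realType).
Variables (mu : {measure set T -> \bar R}) (nu : {measure set T' -> \bar R}).
Local Open Scope ereal_scope.
Import HBNNSimple.

(** The identity for indicators extends by linearity to nonnegative simple functions, then to [f] by
    monotone convergence. It serves twice: to split off one independent factor ([W] the product of
    the others, [nu] a law), and to pass from a law to a density ([W] the density, [X] the
    identity). *)
Lemma ge0_integral_decouple (X : T -> T') (W : T -> R) (c : \bar R)
    (f : T' -> R) :
  measurable_fun setT X ->
  measurable_fun setT W -> (forall t, 0 <= W t)%R -> c \is a fin_num ->
  (forall B, measurable B ->
     \int[mu]_t (W t * \1_B (X t))%:E = c * nu B) ->
  measurable_fun setT f -> (forall x, 0 <= f x)%R ->
  \int[mu]_t (W t * f (X t))%:E = c * \int[nu]_x (f x)%:E.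
Proof.
move=> mX mW W0 c0 H mf f0.
have mfE : measurable_fun [set: T'] (EFin \o f) by exact/measurable_EFinP.
pose f_ := nnsfun_approx measurableT mfE.
have f_cvg x : (f_ n x)%:E @[n --> \oo] --> (f x)%:E.
  by apply: (@cvg_nnsfun_approx _ _ _ _ measurableT _ mfE) => // y _; rewrite lee_fin.
have mfX n : measurable_fun setT (f_ n \o X) by exact: measurableT_comp.
have ndf x m n : (m <= n)%N -> (f_ m x <= f_ n x)%R.
  by move=> mn; exact/lefP/nd_nnsfun_approx.
have step n : \int[mu]_t (W t * f_ n (X t))%:E = c * \int[nu]_x (f_ n x)%:E.
  have mI r : measurable_fun setT (fun t => \1_(f_ n @^-1` [set r]) (X t) : R).
    by apply: measurableT_comp => //; exact: measurable_indic.
  (* A negative [r] is not a value of the approximant, so its indicator vanishes. *)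
  have nn r t : (0 <= r * \1_(f_ n @^-1` [set r]) (X t))%R.
    have [r0|r0] := leP 0%R r; first by rewrite mulr_ge0.
    by rewrite preimage_nnfun0// indic0 mulr0.
  (* Write the simple function as the sum of its values times the indicators of its level sets. *)
  transitivity (\sum_(r \in range (f_ n))
      \int[mu]_t (r * (W t * \1_(f_ n @^-1` [set r]) (X t)))%:E).
    rewrite -ge0_integral_fsum//; last 2 first.
    - by move=> r; apply/measurable_EFinP; do 2 apply: measurable_funM => //.
    - by move=> r t _; rewrite lee_fin mulrCA mulr_ge0.
    apply: eq_integral => t _; rewrite fsumEFin//; congr EFin.
    rewrite {1}(fimfunE (f_ n)) mulr_fsumr//.
    by apply: eq_fsbigr => r _; rewrite mulrCA.
  under [in RHS]eq_integral do rewrite (fimfunE (f_ n)) -fsumEFin//.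
  rewrite ge0_integral_fsum//; last 2 first.
  - by move=> r; apply/measurable_EFinP; apply: measurable_funM.
  - by move=> r x _; rewrite nnfun_muleindic_ge0.
  rewrite ge0_mule_fsumr; last first.
    by move=> r; apply: integral_ge0 => x _; rewrite nnfun_muleindic_ge0.
  apply: eq_fsbigr => r; rewrite inE => -[x _ fxr].
  have r0 : (0 <= r)%R by rewrite -fxr.
  under eq_integral do rewrite EFinM.
  rewrite ge0_integralZl//; last 2 first.
  - by apply/measurable_EFinP; apply: measurable_funM.
  - by move=> t _; rewrite lee_fin mulr_ge0.
  rewrite H//.
  under [in RHS]eq_integral do rewrite EFinM.
  rewrite ge0_integralZl//; last exact/measurable_EFinP.
  rewrite muleCA; congr (_ * (_ * _)).
  by rewrite integral_indic// setIT.
have -> : \int[mu]_t (W t * f (X t))%:E =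
    limn (fun n => \int[mu]_t (W t * f_ n (X t))%:E).
  rewrite -monotone_convergence//.
  - apply: eq_integral => t _; apply/esym/cvg_lim => //.
    under eq_fun do rewrite EFinM.
    by rewrite EFinM; apply: cvgeZl => //; exact: f_cvg.
  - by move=> n; apply/measurable_EFinP; apply: measurable_funM => //; exact: mfX.
  - by move=> n t _; rewrite lee_fin mulr_ge0.
  - by move=> t _ m n mn; rewrite lee_fin ler_wpM2l// ndf.
have -> : \int[nu]_x (f x)%:E = limn (fun n => \int[nu]_x (f_ n x)%:E).
  rewrite -monotone_convergence//.
  - by apply: eq_integral => t _; apply/esym/cvg_lim => //; exact: f_cvg.
  - by move=> n; apply/measurable_EFinP; exact: measurable_funP.
  - by move=> n t _; rewrite lee_fin.
  - by move=> t _ m n mn; rewrite lee_fin ndf.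
(* Pulling [c] out of the limit requires convergence, which holds because the integrals increase
   with [n]. *)
rewrite -limeMl//; first by congr (limn _); apply/funext => n; rewrite step.
apply/ereal_nondecreasing_is_cvgn => m n mn; apply: ge0_le_integral => //.
- by move=> t _; rewrite lee_fin.
- by apply/measurable_EFinP; exact: measurable_funP.
- by apply/measurable_EFinP; exact: measurable_funP.
- by move=> t _; rewrite lee_fin ndf.
Qed.

End Decoupling.

Lemma Ereal_Rintegral d (T : measurableType d) (R : realType)
  (P : probability T R) (X : T -> R) : Ereal P X = \int[P]_w X w.
Proof. by rewrite /Ereal unlock. Qed.

Section IndependentProduct.
Context d (T : measurableType d) (R : realType) (P : probability T R)
  (I : finType) (g : I -> {RV P >-> R}).
Hypothesis g_indep : mutually_independent g.
Implicit Type f : I -> R -> R.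

Let measurable_comp f : (forall i, measurable_fun setT (f i)) ->
  forall i, measurable_fun setT (fun w => f i (g i w)).
Proof. by move=> mf i; apply: measurableT_comp. Qed.

(* For indicators this is the definition of independence; the general case
   replaces one indicator at a time. *)
Let ge0_integral_prod f :
  (forall i, measurable_fun setT (f i)) -> (forall i x, 0 <= f i x) ->
  (forall i, \int[P]_w (f i (g i w))%:E < +oo)%E ->
  (\int[P]_w (\prod_i f i (g i w))%:E = \prod_i \int[P]_w (f i (g i w))%:E)%E.
Proof.
(* Induction on a list [s] of the indices whose factor may be arbitrary; outside [s] every factor is
   an indicator. *)
suff H (s : seq I) : forall f,
    (forall i, measurable_fun setT (f i)) -> (forall i x, 0 <= f i x) ->
    (forall i, \int[P]_w (f i (g i w))%:E < +oo)%E ->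
    (forall i, i \notin s -> exists2 B, measurable B & f i = \1_B) ->
    (\int[P]_w (\prod_i f i (g i w))%:E = \prod_i \int[P]_w (f i (g i w))%:E)%E.
  by move=> mf f0 ff; apply: (H (enum I)) => // i; rewrite mem_enum.
elim: s => [|i s IH] {}f mf f0 ffin fB.
  have /choice[B BP] : forall i, exists B, measurable B /\ f i = \1_B.
    by move=> i; have [B] := fB i isT; exists B.
  have mB i : measurable (B i) by have [] := BP i.
  have fE i : f i = \1_(B i) by have [] := BP i.
  have mgB i : measurable (g i @^-1` B i).
    by rewrite -[_ @^-1` _]setTI; exact: measurable_funP.
  have -> : (fun w => (\prod_i f i (g i w))%:E) =
      (fun w => (\1_[set w | forall i, B i (g i w)] w)%:E : \bar R).
    apply/funext => w; congr EFin; rewrite indicE.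
    have [Bw|nBw] := pselect (forall i, B i (g i w)).
      by rewrite mem_set// big1// => i _; rewrite fE indicE mem_set.
    rewrite memNset//; move/existsNP: nBw => [i nBi].
    by rewrite (bigD1 i)//= fE indicE memNset// mul0r.
  have mI : measurable [set w | forall i, B i (g i w)].
    rewrite (_ : [set _ | _] = \bigcap_(i in [set: I]) (g i @^-1` B i)).
      by apply: fin_bigcap_measurable => //; exact: finite_finset.
    by apply/seteqP; split => [w Bw i _|w Bw i]; exact: Bw.
  rewrite integral_indic// setIT.
  transitivity (\prod_i P (g i @^-1` B i))%E; first exact: g_indep.
  apply: eq_bigr => i _.
  rewrite (_ : (fun w => _) = (fun w => (\1_(g i @^-1` B i) w)%:E)).
    by rewrite integral_indic// setIT.
  by apply/funext => w; rewrite fE.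
pose W w := \prod_(j | j != i) f j (g j w).
pose c := (\prod_(j | j != i) \int[P]_w (f j (g j w))%:E)%E.
have prodE w : \prod_j f j (g j w) = W w * f i (g i w).
  by rewrite (bigD1 i)//= mulrC.
under eq_integral do rewrite prodE.
rewrite [RHS](bigD1 i)//= -/c muleC.
(* Integrating factor [i] against its own law gives the goal the shape of a decoupling, with [W] the
   other factors and [c] their expectations. *)
rewrite -(ge0_integral_distribution (g i) (f := EFin \o f i))//; last 2 first.
- exact/measurable_EFinP.
- by move=> x; rewrite lee_fin.
apply: ge0_integral_decouple => //.
- rewrite /W; under eq_fun do rewrite -big_filter.
  by apply: measurable_prod => j _; exact: measurable_comp.
- by move=> w; apply: prodr_ge0.
- rewrite /c; apply: prode_fin_num => j _; rewrite ge0_fin_numE//.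
  by apply: integral_ge0 => w _; rewrite lee_fin.
move=> B mB.
(* Once factor [i] is an indicator, the induction hypothesis yields what the decoupling asks for. *)
pose f' j : R -> R := if j == i then \1_B else f j.
have f'E j : j != i -> f' j = f j by rewrite /f' => /negPf->.
have f'i : f' i = \1_B by rewrite /f' eqxx.
have mgB : measurable (g i @^-1` B).
  by rewrite -[_ @^-1` _]setTI; exact: measurable_funP.
have iB : (\int[P]_w (\1_B (g i w))%:E = P (g i @^-1` B))%E.
  rewrite (_ : (fun w => _) = (fun w => (\1_(g i @^-1` B) w)%:E))//.
  by rewrite integral_indic// setIT.
have := IH f'; rewrite (bigD1 i)//= f'i iB.
rewrite (eq_bigr (fun j => \int[P]_w (f j (g j w))%:E)%E); last first.
  by move=> j ji; rewrite f'E.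
rewrite -/c muleC => <-.
- apply: eq_integral => w _; rewrite [in RHS](bigD1 i)//= f'i mulrC.
  by congr (_ * _)%:E; apply: eq_bigr => j ji; rewrite f'E.
- by move=> j; rewrite /f'; case: ifP => // _; exact: measurable_indic.
- by move=> j x; rewrite /f'; case: ifP.
- move=> j; have [->|ji] := eqVneq j i; last by rewrite f'E.
  by rewrite f'i iB (le_lt_trans (probability_le1 P mgB))// ltry.
- move=> j js; have [->|ji] := eqVneq j i; first by exists B.
  by rewrite f'E//; apply: fB; rewrite inE negb_or ji.
Qed.

(** The nonnegative product formula applied to the absolute values bounds the integral by a finite
    product. *)
Lemma integrable_prod_indep f :
  (forall i, measurable_fun setT (f i)) ->
  (forall i, P.-integrable setT (EFin \o (fun w => f i (g i w)))) ->
  P.-integrable setT (EFin \o (fun w => \prod_i f i (g i w))).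
Proof.
move=> mf intf; apply/integrableP; split.
  by apply/measurable_EFinP; apply: measurable_prod => i _; exact: measurable_comp.
have fin i : (\int[P]_w (`|f i (g i w)|)%:E < +oo)%E.
  by have /integrableP[_] := intf i.
under eq_integral do rewrite /= normr_prod.
rewrite (@ge0_integral_prod (fun i x => `|f i x|))//; last first.
  by move=> i; apply: measurableT_comp.
rewrite -ge0_fin_numE; last first.
  by apply: prode_ge0 => i _; apply: integral_ge0 => w _; rewrite lee_fin.
apply: prode_fin_num => i _; rewrite ge0_fin_numE//.
by apply: integral_ge0 => w _; rewrite lee_fin.
Qed.

(** Both sides are linear in each factor, so a signed factor may be split into positive and negative
    parts, one index at a time, until the nonnegative case applies. *)
Lemma Ereal_prod_indep f :
  (forall i, measurable_fun setT (f i)) ->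
  (forall i, P.-integrable setT (EFin \o (fun w => f i (g i w)))) ->
  Ereal P (fun w => \prod_i f i (g i w)) = \prod_i Ereal P (fun w => f i (g i w)).
Proof.
under [in RHS]eq_bigr do rewrite Ereal_Rintegral.
rewrite Ereal_Rintegral.
(* Here [s] lists the indices whose factor may change sign. *)
suff H (s : seq I) : forall f,
    (forall i, measurable_fun setT (f i)) ->
    (forall i, P.-integrable setT (EFin \o (fun w => f i (g i w)))) ->
    (forall i, i \notin s -> forall x, 0 <= f i x) ->
    \int[P]_w (\prod_i f i (g i w)) = \prod_i \int[P]_w f i (g i w).
  by move=> mf intf; apply: (H (enum I)) => // i; rewrite mem_enum.
elim: s => [|i s IH] {}f mf intf f0.
  have fin i : (\int[P]_w (f i (g i w))%:E)%E \is a fin_num.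
    by apply: integrable_fin_num => //; exact: intf.
  rewrite /Rintegral ge0_integral_prod//; last 2 first.
  - by move=> i; exact: f0.
  - by move=> i; rewrite -ge0_fin_numE//; apply: integral_ge0 => w _; rewrite lee_fin f0.
  apply: EFin_inj; rewrite -prodEFin fineK; last exact: prode_fin_num.
  by apply: eq_bigr => i _; rewrite fineK.
pose up h j : R -> R := if j == i then h else f j.
have upE h j : j != i -> up h j = f j by rewrite /up => /negPf->.
have upi h : up h i = h by rewrite /up eqxx.
have mup (h : R -> R) : measurable_fun setT h -> forall j, measurable_fun setT (up h j).
  by move=> mh j; rewrite /up; case: ifP.
have intup h : P.-integrable setT (EFin \o (fun w => h (g i w))) ->
    forall j, P.-integrable setT (EFin \o (fun w => up h j (g j w))).
  by move=> ih j; have [->|ji] := eqVneq j i; rewrite ?upi// upE.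
have upprod h w : \prod_j up h j (g j w) = h (g i w) * \prod_(j | j != i) f j (g j w).
  rewrite (bigD1 i)//= upi; congr (_ * _).
  by apply: eq_bigr => j ji; rewrite upE.
have IHup (h : R -> R) : measurable_fun setT h ->
    P.-integrable setT (EFin \o (fun w => h (g i w))) -> (forall x, 0 <= h x) ->
    \int[P]_w (\prod_j up h j (g j w)) =
    \int[P]_w h (g i w) * \prod_(j | j != i) \int[P]_w f j (g j w).
  move=> mh ih h0; rewrite IH//.
  - rewrite (bigD1 i)//= upi; congr (_ * _).
    by apply: eq_bigr => j ji; rewrite upE.
  - exact: mup.
  - exact: intup.
  - move=> j js x; have [->|ji] := eqVneq j i; first by rewrite upi.
    by rewrite upE// f0// inE negb_or ji.
(* Positive and negative parts of factor [i]; both are dominated by its absolute value, hence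
   integrable. *)
pose fp x : R := Num.max (f i x) 0; pose fm x : R := Num.max (- f i x) 0.
have fpm x : f i x = fp x - fm x.
  rewrite /fp /fm; have /orP[h|h] := le_total 0 (f i x).
    by rewrite max_l// max_r ?oppr_le0// subr0.
  by rewrite max_r// max_l ?oppr_ge0// sub0r opprK.
have mfp : measurable_fun setT fp by exact: measurable_maxr.
have mfm : measurable_fun setT fm.
  by apply: measurable_maxr => //; exact: measurableT_comp.
have dom (h : R -> R) : measurable_fun setT h -> (forall x, `|h x| <= `|f i x|) ->
    P.-integrable setT (EFin \o (fun w => h (g i w))).
  move=> mh hf; apply: le_integrable (intf i) => //.
  - by apply/measurable_EFinP; exact: measurableT_comp.
  - by move=> w _ /=; rewrite lee_fin; exact: hf.
have ifp : P.-integrable setT (EFin \o (fun w => fp (g i w))).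
  apply: dom => // x; rewrite /fp; have /orP[h|h] := le_total 0 (f i x).
    by rewrite max_l.
  by rewrite max_r// normr0.
have ifm : P.-integrable setT (EFin \o (fun w => fm (g i w))).
  apply: dom => // x; rewrite /fm; have /orP[h|h] := le_total 0 (f i x).
    by rewrite max_r ?oppr_le0// normr0.
  by rewrite max_l ?oppr_ge0// normrN.
have int2 (h : R -> R) : measurable_fun setT h ->
    P.-integrable setT (EFin \o (fun w => h (g i w))) ->
    P.-integrable setT (EFin \o (fun w => \prod_j up h j (g j w))).
  by move=> mh ih; apply: integrable_prod_indep; [exact: mup|exact: intup].
transitivity (\int[P]_w (\prod_j up fp j (g j w) - \prod_j up fm j (g j w))).
  by apply: eq_Rintegral => w _; rewrite !upprod -mulrBl -fpm (bigD1 i).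
rewrite RintegralB//; [|exact: int2..].
rewrite !IHup//; last 2 first.
- by move=> x; rewrite le_max lexx orbT.
- by move=> x; rewrite le_max lexx orbT.
rewrite -mulrBl -RintegralB// [RHS](bigD1 i)//=; congr (_ * _).
by apply: eq_Rintegral => w _; rewrite -fpm.
Qed.

End IndependentProduct.

(** * Moments of the standard normal distribution *)

Section NormalMoments.
Context (R : realType).
Notation mu := (@lebesgue_measure R).
Notation p := (@normal_pdf R 0 1).

Lemma std_normal_pdfE x : p x = normal_peak 1 * expR (- (x ^+ 2 / 2)).
Proof.
by rewrite normal_pdfE ?oner_eq0// /normal_fun subr0 expr1n mulNr.
Qed.

Lemma normal_pdfN x : p (- x) = p x.
Proof. by rewrite !std_normal_pdfE sqrrN. Qed.

(** The equation p' = -x p makes -p a primitive of x p, which drives the recursion of the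
    moments. *)
Lemma is_derive_normal_pdf (x : R) : is_derive x 1 p (- (x * p x)).
Proof.
have d1 : is_derive x 1 (fun x : R => - (x ^+ 2 / 2)) (- x).
  have := @is_deriveX R R id 2 x 1 1 (is_derive_id x 1).
  move=> /(@is_deriveZ R R R _ (- 2^-1)).
  have -> : - 2^-1 \*: (id ^+ 2) = (fun x : R => - (x ^+ 2 / 2)).
    by apply/funext => y; rewrite exprfctE /= scaleNr mulrC.
  by congr is_derive; rewrite /GRing.scale /= expr1; field.
have := @is_deriveZ R R R _ (normal_peak 1) _ _ _ (is_derive1_comp (is_derive_expR _) d1).
have -> : normal_peak 1 \*: (expR \o (fun x : R => - (x ^+ 2 / 2))) = p.
  by apply/funext => y; rewrite std_normal_pdfE.
by congr is_derive; rewrite std_normal_pdfE /GRing.scale /=; ring.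
Qed.

Let continuous_p : continuous p.
Proof. by apply: continuous_normal_pdf; rewrite oner_eq0. Qed.

Lemma continuous_exprn_pdf k : continuous (fun x : R => x ^+ k * p x).
Proof.
by move=> x; apply: cvgM; [exact: exprn_continuous|exact: continuous_p].
Qed.

(** Integration by parts of x^(k+1) against x p, whose primitive is -p. *)
Lemma integral_pdf_parts k (a b : R) : a < b ->
  (\int[mu]_(x in `[a, b]) (x ^+ k.+2 * p x)%:E =
   (a ^+ k.+1 * p a - b ^+ k.+1 * p b)%:E +
   k.+1%:R%:E * \int[mu]_(x in `[a, b]) (x ^+ k * p x)%:E)%E.
Proof.
move=> ab.
have cE (F : R -> R) : continuous F -> {within `[a, b], continuous F}.
  exact: continuous_subspaceT.
have dLR (F f : R -> R) : (forall x : R, is_derive x 1 F (f x)) ->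
    derivable_oo_LRcontinuous F a b.
  move=> dF.
  have cF x : {for x, continuous F}.
    by apply: differentiable_continuous; apply/derivable1_diffP.
  split; first by move=> x _; have [] := dF x.
  - by apply: cvg_at_right_filter; exact: cF.
  - by apply: cvg_at_left_filter; exact: cF.
have dF (x : R) : is_derive x 1 (fun x : R => x ^+ k.+1) (k.+1%:R * x ^+ k).
  have := @is_deriveX R R id k.+1 x 1 1 (is_derive_id x 1).
  by rewrite exprfctE; congr is_derive; rewrite /GRing.scale /= mulr1.
have dG (x : R) : is_derive x 1 (- p) (x * p x).
  by have := @is_deriveN R R R _ _ _ _ (is_derive_normal_pdf x); rewrite opprK.
have d1 (F f : R -> R) : (forall x : R, is_derive x 1 F (f x)) ->
    {in `]a, b[, F^`()%classic =1 f}.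
  by move=> h x _; rewrite derive1E; have [] := h x.
have := @integration_by_parts R (fun x => x ^+ k.+1) (- p) _ _ a b ab
  _ (dLR _ _ dF) (d1 _ _ dF) _ (dLR _ _ dG) (d1 _ _ dG).
rewrite (_ : (fun x => _) = (fun x => (x ^+ k.+2 * p x)%:E)); last first.
  by apply/funext => x; rewrite mulrA -exprSr.
move=> ->; first last.
- apply: cE => x; have := @continuous_exprn_pdf 1 x.
  by under eq_fun do rewrite expr1.
- apply: cE => x; apply: cvgM; first exact: cvg_cst.
  exact: exprn_continuous.
congr (_ + _)%E; first by rewrite /= !mulrN opprK addrC.
have int_p : mu.-integrable `[a, b] (fun x => (x ^+ k * p x)%:E).
  apply: continuous_compact_integrable => //; first exact: segment_compact.
  by apply: cE; exact: continuous_exprn_pdf.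
set J := (\int[mu]_(x in `[a, b]) (x ^+ k * p x)%:E)%E.
transitivity (- ((- k.+1%:R)%:E * J))%E; last by rewrite EFinN mulNe oppeK.
rewrite /J -integralZl//; congr (- _)%E.
by apply: eq_integral => x _; rewrite -EFinM mulrN mulNr mulrA.
Qed.



(** Makes the boundary term of the integration by parts vanish at infinity. With x = n+1, one term
    of the exponential series of x^2/2 bounds the product by a constant times x^-(k+1), hence by a
    constant times 1/x. *)
Lemma cvg_exprn_pdf k :
  (n.+1%:R ^+ k.+1 * p n.+1%:R : R) @[n --> \oo] --> (0 : R).
Proof.
(* The factors (k+1)! and 2^(k+1) come from inverting the series term (x^2/2)^(k+1) / (k+1)!. *)
pose C : R := normal_peak 1 * (k.+1`!%:R * 2 ^+ k.+1).
have c0 : 0 <= normal_peak (1 : R) by exact: normal_peak_ge0.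
apply: (@squeeze_cvgr _ _ _ _ (fun=> 0) (fun n => C * harmonic n)); first last.
- rewrite -[X in _ --> X](mulr0 C); apply: cvgM; first exact: cvg_cst.
  exact: cvg_harmonic.
- exact: cvg_cst.
near=> n; set x : R := n.+1%:R.
have x1 : 1 <= x by rewrite ler1n.
have x0 : 0 < x by rewrite ltr0n.
rewrite mulr_ge0 ?exprn_ge0 ?normal_pdf_ge0 ?(ltW x0)//=.
rewrite std_normal_pdfE mulrCA /C -(mulrA (normal_peak 1)) ler_wpM2l// expRN /= -/x.
have fact0 : 0 < k.+1`!%:R :> R by rewrite ltr0n fact_gt0.
have y0 : 0 < (x ^+ 2 / 2) ^+ k.+1 / k.+1`!%:R by rewrite !(divr_gt0, exprn_gt0).
have := @expR_ge1Dxn R (x ^+ 2 / 2) k (divr_ge0 (exprn_ge0 2 (ltW x0)) (ler0n _ 2)).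
move=> /(le_trans (ltW (ltr_pwDl ltr01 (lexx _)))) => expR_ge.
apply: (@le_trans _ _ (x ^+ k.+1 * ((x ^+ 2 / 2) ^+ k.+1 / k.+1`!%:R)^-1)).
  by rewrite ler_wpM2l ?exprn_ge0 ?(ltW x0)// lef_pV2 ?posrE ?expR_gt0.
rewrite invf_div expr_div_n invf_div -exprM mulnC exprM.
have -> : x ^+ k.+1 * (k.+1`!%:R * (2 ^+ k.+1 / (x ^+ k.+1) ^+ 2)) =
    k.+1`!%:R * 2 ^+ k.+1 * (x ^+ k.+1)^-1.
  by field; rewrite gt_eqF// exprn_gt0.
rewrite !ler_wpM2l ?exprn_ge0 ?(ltW fact0)// lef_pV2 ?posrE ?exprn_gt0//.
by rewrite exprS ler_peMr ?(ltW x0)// exprn_ege1.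
Unshelve. all: by end_near. Qed.

Let measurable_exprn_pdf k : measurable_fun [set: R] (fun x : R => x ^+ k * p x).
Proof. by apply: measurable_funM => //; exact: measurable_normal_pdf. Qed.

Let even_exprn_pdf_ge0 k (x : R) : 0 <= x ^+ k.*2 * p x.
Proof. by rewrite mulr_ge0 ?normal_pdf_ge0// -mul2n exprM exprn_ge0// sqr_ge0. Qed.

Let integralT_even (f : R -> R) : (forall x, 0 <= f x) -> continuous f ->
  (forall x, f (- x) = f x) ->
  (\int[mu]_x (f x)%:E = 2%:E * \int[mu]_(x in `[0%R, +oo[) (f x)%:E)%E.
Proof.
move=> f0 cf fN; rewrite ge0_symfun_integralT// => [|x]; last by rewrite /= fN.
rewrite (_ : [set x | _] = `[0%R, +oo[%classic)//.
by apply/seteqP; split => x /=; rewrite in_itv/= andbT.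
Qed.

(** The base case is half of the total mass 1; the inductive step passes the integration by parts on
    [0, n+1] to the limit. *)
Let integral0y_even_exprn_pdf k :
  (\int[mu]_(x in `[0%R, +oo[) (x ^+ k.*2 * p x)%:E =
   (2^-1 * \prod_(i < k) i.*2.+1%:R)%:E)%E.
Proof.
elim: k => [|k IH].
  have : (\int[mu]_x (p x)%:E = 1)%E by exact: integral_normal_pdf.
  rewrite (integralT_even _ (@normal_pdf_ge0 _ _ _) continuous_p normal_pdfN) => h.
  rewrite big_ord0 mulr1.
  under eq_integral do rewrite expr0 mul1r.
  rewrite -[RHS]mule1 -h muleA -EFinM mulVf ?mul1e//.
rewrite big_ord_recr /= mulrA mulrC EFinM -IH.
set H := (\int[mu]_(x in `[0%R, +oo[) (x ^+ k.*2 * p x)%:E)%E.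
have Hfin : H \is a fin_num by rewrite /H IH.
pose v n : \bar R := (\int[mu]_(x in `[0%R, n%:R]) (x ^+ k.*2 * p x)%:E)%E.
have cv : v n.+1 @[n --> \oo] --> H.
  by rewrite (cvg_shiftS v); exact: ge0_cvgn_integral.
have := @ge0_cvgn_integral R mu _ (even_exprn_pdf_ge0 k.+1) (measurable_exprn_pdf k.+1.*2).
rewrite doubleS -cvg_shiftS => cu.
(* The endpoint n+1 keeps the interval nondegenerate; the boundary term at 0 vanishes because its
   exponent is positive. *)
have uE n : (\int[mu]_(x in `[0%R, n.+1%:R]) (x ^+ k.*2.+2 * p x)%:E =
    (- (n.+1%:R ^+ k.*2.+1 * p n.+1%:R))%:E + k.*2.+1%:R%:E * v n.+1)%E.
  by rewrite integral_pdf_parts ?ltr0n// expr0n /= mul0r sub0r.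
have cu' : ((- (n.+1%:R ^+ k.*2.+1 * p n.+1%:R))%:E +
    k.*2.+1%:R%:E * v n.+1)%E @[n --> \oo] --> (0%:E + k.*2.+1%:R%:E * H)%E.
  apply: cvgeD.
  - by rewrite fin_num_adde_defr.
  - apply/cvg_EFin; first exact: nearW.
    by have := cvgN (cvg_exprn_pdf k.*2); rewrite oppr0; exact.
  - by apply: cvgeZl.
apply: (cvg_unique _ cu) => //; rewrite add0e in cu'.
by apply: cvg_trans cu'; apply: near_eq_cvg; apply: nearW => n; rewrite /= uE.
Qed.

Lemma integral_even_exprn_pdf k :
  (\int[mu]_x (x ^+ k.*2 * p x)%:E = (\prod_(i < k) i.*2.+1%:R)%:E)%E.
Proof.
rewrite integralT_even//; last 2 first.
- exact: continuous_exprn_pdf.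
- by move=> x; rewrite normal_pdfN -mul2n !exprM sqrrN.
by rewrite integral0y_even_exprn_pdf -EFinM mulrA divff// mul1r.
Qed.

(** Evenness of the integrand. The half-line is encoded by an indicator factor, so that both sides
    are integrals of a function against the density on the whole line, as the odd moments
    require. *)
Lemma integral_abs_exprn_pdf k :
  (\int[mu]_x (`|x ^+ k| * p x)%:E =
   2%:E * \int[mu]_x (`|x ^+ k| * \1_`[0%R, +oo[ x * p x)%:E)%E.
Proof.
rewrite integralT_even; last 3 first.
- by move=> x; rewrite mulr_ge0 ?normal_pdf_ge0.
- move=> x; apply: cvgM; last exact: continuous_p.
  by apply: (@cvg_norm _ R); exact: exprn_continuous.
- by move=> x; rewrite normal_pdfN exprNn normrM normrX normrN1 expr1n mul1r.
congr (_ * _)%E; rewrite integral_mkcond; apply: eq_integral => x _.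
rewrite patchE indicE; case: ifPn => _; first by rewrite mulr1.
by rewrite mulr0 mul0r.
Qed.

End NormalMoments.

Section StdNormalVariable.
Context d (T : measurableType d) (R : realType) (P : probability T R)
  (X : {RV P >-> R}).
Hypothesis X_normal : std_normal X.
Notation mu := (@lebesgue_measure R).
Notation p := (@normal_pdf R 0 1).

(** By [X_normal] the law of [X] and the measure with density [p] agree on measurable sets;
    decoupling with the identity map and constant 1 extends this to functions. *)
Lemma ge0_integral_std_normal (f : R -> R) :
  measurable_fun setT f -> (forall x, 0 <= f x) ->
  (\int[P]_w (f (X w))%:E = \int[mu]_x (f x * p x)%:E)%E.
Proof.
move=> mf f0.
rewrite -(ge0_integral_distribution X (f := EFin \o f))//; last first.
  exact/measurable_EFinP.
under [in RHS]eq_integral do rewrite mulrC.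
rewrite -[LHS]mul1e; apply/esym.
apply: (@ge0_integral_decouple _ _ _ _ _ mu (distribution P X) id) => //.
- exact: measurable_normal_pdf.
- exact: normal_pdf_ge0.
move=> B mB; rewrite mul1e [RHS]X_normal// /normal_prob [RHS]integral_mkcond.
apply: eq_integral => x _; rewrite patchE indicE.
by case: ifPn => _; rewrite ?mulr1 ?mulr0.
Qed.

Let measurable_exprn k : measurable_fun setT (fun w => X w ^+ k).
Proof. exact: measurable_funX. Qed.

Let integral_even_exprn k :
  (\int[P]_w (X w ^+ k.*2)%:E = (\prod_(i < k) i.*2.+1%:R)%:E)%E.
Proof.
rewrite (@ge0_integral_std_normal (fun x => x ^+ k.*2)).
- exact: integral_even_exprn_pdf.
- exact: measurable_funX.
- by move=> x; rewrite -mul2n exprM exprn_ge0// sqr_ge0.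
Qed.

(** Since |y| <= 1 + y^2, the k-th power is dominated by 1 plus the 2k-th power, whose integral is
    finite. *)
Lemma integrable_std_normal_exprn k :
  P.-integrable setT (EFin \o (fun w => X w ^+ k)).
Proof.
have int_even j : P.-integrable setT (EFin \o (fun w => X w ^+ j.*2)).
  apply/integrableP; split; first exact/measurable_EFinP.
  under eq_integral do rewrite /= ger0_norm ?exprn_even_ge0 ?odd_double//.
  by rewrite integral_even_exprn ltry.
have int1 : P.-integrable setT (EFin \o (fun=> 1 : R)).
  exact: finite_measure_integrable_cst.
apply: (@le_integrable _ _ _ _ _ _ _ (EFin \o (fun w => 1 + X w ^+ k.*2))) => //.
- exact/measurable_EFinP.
- move=> w _ /=; rewrite lee_fin -muln2 exprM.
  set y := X w ^+ k.
  have y2 : 0 <= y ^+ 2 by exact: sqr_ge0.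
  rewrite [leRHS]ger0_norm ?addr_ge0//.
  by rewrite -(real_normK (num_real y)); nra.
- exact: (integrableD measurableT int1 (int_even k)).
Qed.

(** For even [k] the product is the double factorial (k-1)!!. *)
Definition std_normal_moment k : R :=
  if odd k then 0 else \prod_(i < k./2) i.*2.+1%:R.

Lemma Ereal_std_normal_exprn k :
  Ereal P (fun w => X w ^+ k) = std_normal_moment k.
Proof.
rewrite Ereal_Rintegral /std_normal_moment; case: ifPn => [ok|/even_halfK ek].
  (* For odd [k], x^k equals 2 [f] minus |x^k|, with [f] the part of |x^k| on the nonnegative
     half-line. By symmetry of the density the two terms have the same expectation. *)
  pose f x : R := `|x ^+ k| * \1_`[0%R, +oo[ x.
  have mabs : measurable_fun [set: R] (fun x : R => `|x ^+ k|).
    by apply: measurableT_comp => //; exact: measurable_funX.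
  have mf : measurable_fun setT f.
    by apply: measurable_funM => //; exact: measurable_indic.
  have f0 x : 0 <= f x by rewrite mulr_ge0.
  have split_odd x : x ^+ k = 2 * f x - `|x ^+ k|.
    rewrite /f indicE; have [x0|x0] := leP 0 x.
      rewrite mem_set /= ?in_itv/= ?x0// mulr1 ger0_norm ?exprn_ge0//; ring.
    rewrite memNset /= ?in_itv/= ?andbT ?lt_geF// !mulr0 sub0r.
    by rewrite normrX (ltr0_norm x0) exprNn -signr_odd ok expr1 mulN1r opprK.
  have int_abs : P.-integrable setT (EFin \o (fun w => `|X w ^+ k|)).
    exact: (integrable_norm (integrable_std_normal_exprn k)).
  have int_f : P.-integrable setT (EFin \o (fun w => f (X w))).
    apply: le_integrable int_abs => //.
      by apply/measurable_EFinP; exact: measurableT_comp.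
    by move=> w _ /=; rewrite lee_fin normr_id ger0_norm// /f ler_piMr.
  transitivity (\int[P]_w (2 * f (X w) - `|X w ^+ k|)).
    by apply: eq_Rintegral => w _.
  rewrite RintegralB//; last first.
    exact: (integrableZl measurableT 2 int_f).
  rewrite RintegralZl// /Rintegral (ge0_integral_std_normal f)//.
  rewrite (ge0_integral_std_normal (fun x => `|x ^+ k|))//.
  rewrite integral_abs_exprn_pdf fineM// ?subrr//.
  rewrite -/(f _) -(ge0_integral_std_normal f)//.
  exact: integrable_fin_num.
by rewrite -{1}ek /Rintegral integral_even_exprn.
Qed.

End StdNormalVariable.

(** * Isserlis' formula *)

Section Wick.
Context d (T : measurableType d) (R : realType) (P : probability T R)
  (I : finType) (g : I -> {RV P >-> R}).
Hypothesis g_indep : mutually_independent g.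
Hypothesis g_normal : forall i, std_normal (g i).
Notation moment := (@std_normal_moment R).

Lemma integrable_monomial (e : I -> nat) :
  P.-integrable setT (EFin \o (fun w => \prod_x g x w ^+ e x)).
Proof.
apply: (@integrable_prod_indep _ _ _ _ _ _ g_indep (fun x y => y ^+ e x)) => x.
  exact: measurable_funX.
exact: integrable_std_normal_exprn.
Qed.

Lemma Ereal_monomial (e : I -> nat) :
  Ereal P (fun w => \prod_x g x w ^+ e x) = \prod_x moment (e x).
Proof.
rewrite (@Ereal_prod_indep _ _ _ _ _ _ g_indep (fun x y => y ^+ e x)).
- by apply: eq_bigr => x _; exact: Ereal_std_normal_exprn.
- by move=> x; exact: measurable_funX.
- by move=> x; exact: integrable_std_normal_exprn.
Qed.

Let moment0 : moment 0 = 1. Proof. by rewrite /std_normal_moment big_ord0. Qed.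
Let moment2 : moment 2 = 1.
Proof. by rewrite /std_normal_moment big_ord_recl big_ord0 mulr1. Qed.
Let moment4 : moment 4 = 3.
Proof. by rewrite /std_normal_moment !big_ord_recl big_ord0 mulr1 mul1r. Qed.

(** Writes a single factor as a monomial over all of [I], the truth value [x == i] being the
    exponent; in products, repeated indices then add up their exponents. *)
Let prod_exp1 (y : I -> R) i : \prod_x y x ^+ (x == i) = y i.
Proof.
rewrite (bigD1 i)//= eqxx expr1 big1 ?mulr1// => x /negPf->.
by rewrite expr0.
Qed.

Let odd_moment0 (e : I -> nat) x : odd (e x) -> \prod_x moment (e x) = 0.
Proof. by move=> ox; rewrite (bigD1 x)//= {1}/std_normal_moment ox mul0r. Qed.

Let moment_pair i k : i != k ->
  \prod_(x : I) moment ((x == i) + (x == i) + (x == k) + (x == k))%N = 1.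
Proof.
move=> ik; have /negPf ki : k != i by rewrite eq_sym.
rewrite (bigD1 i)//= eqxx (negPf ik) moment2 mul1r.
rewrite (bigD1 k) ?ki//= eqxx moment2 mul1r.
by rewrite big1// => x /andP[/negPf-> /negPf->].
Qed.

Lemma integrable_mul2 i j : P.-integrable setT (EFin \o (fun w => g i w * g j w)).
Proof.
have := integrable_monomial (fun x => (x == i) + (x == j))%N.
congr (_.-integrable _ (EFin \o _)); apply/funext => w.
under eq_bigr do rewrite !exprD.
by rewrite !big_split /= !prod_exp1.
Qed.

Lemma Ereal_mul2 i j : Ereal P (fun w => g i w * g j w) = (i == j)%:R.
Proof.
have -> : (fun w => g i w * g j w) =
    (fun w => \prod_x g x w ^+ ((x == i) + (x == j))).
  apply/funext => w; under eq_bigr do rewrite !exprD.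
  by rewrite !big_split /= !prod_exp1.
rewrite Ereal_monomial; have [<-|ij] := eqVneq i j.
  by rewrite (bigD1 i)//= big1 => [|x /negPf->]; rewrite ?eqxx ?moment2 ?mulr1.
by rewrite (odd_moment0 _ i) ?eqxx ?(negPf ij).
Qed.

Lemma integrable_mul4 i j k l :
  P.-integrable setT (EFin \o (fun w => g i w * g j w * g k w * g l w)).
Proof.
have := integrable_monomial (fun x => (x == i) + (x == j) + (x == k) + (x == l))%N.
congr (_.-integrable _ (EFin \o _)); apply/funext => w.
under eq_bigr do rewrite !exprD.
by rewrite !big_split /= !prod_exp1.
Qed.

(** Four equal indices give the fourth moment 3, two distinct pairs give 1, and in any other pattern
    some index has an odd exponent and the expectation is 0. *)
Lemma Ereal_mul4 i j k l :
  Ereal P (fun w => g i w * g j w * g k w * g l w) =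
  (i == j)%:R * (k == l)%:R + (i == k)%:R * (j == l)%:R
  + (i == l)%:R * (j == k)%:R.
Proof.
have -> : (fun w => g i w * g j w * g k w * g l w) =
    (fun w => \prod_x g x w ^+ ((x == i) + (x == j) + (x == k) + (x == l))).
  apply/funext => w; under eq_bigr do rewrite !exprD.
  by rewrite !big_split /= !prod_exp1.
rewrite Ereal_monomial.
have symF (a b : I) : a != b -> (b == a) = false by rewrite eq_sym => /negPf.
have [<-|ij] := eqVneq i j.
  have [<-|kl] := eqVneq k l.
    have [<-|ik] := eqVneq i k; last by rewrite moment_pair//=; ring.
    rewrite (bigD1 i)//= big1 => [|x /negPf xi]; last by rewrite xi moment0.
    by rewrite !eqxx moment4 /=; ring.
  have [ik|ik] := eqVneq i k.
    rewrite -ik in kl *; rewrite (odd_moment0 _ l) ?(negPf kl) ?eqxx ?(symF _ _ kl)//=; ring.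
  by rewrite (odd_moment0 _ k) ?(negPf ik) ?eqxx ?(symF _ _ ik) ?(negPf kl)//=; ring.
have [<-|ik] := eqVneq i k.
  have [<-|il] := eqVneq i l.
    rewrite (odd_moment0 _ i) ?eqxx ?(symF _ _ ij) ?(negPf ij)//=; ring.
  have [<-|jl] := eqVneq j l.
    transitivity (1 : R); last by rewrite (symF _ _ ij) /=; ring.
    rewrite -[RHS](moment_pair _ _ ij).
    by apply: eq_bigr => x _; congr moment; case: (x == i); case: (x == j).
  by rewrite (odd_moment0 _ j) ?eqxx ?(symF _ _ ij) ?(negPf jl)//=; ring.
have [<-|il] := eqVneq i l.
  have [<-|jk] := eqVneq j k.
    transitivity (1 : R); last by rewrite /=; ring.
    rewrite -[RHS](moment_pair _ _ ij).
    by apply: eq_bigr => x _; congr moment; case: (x == i); case: (x == j).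
  by rewrite (odd_moment0 _ j) ?eqxx ?(symF _ _ ij) ?(negPf jk)//=; ring.
by rewrite (odd_moment0 _ i) ?eqxx ?(negPf ij) ?(negPf ik) ?(negPf il)//=; ring.
Qed.

End Wick.

(** * Quadratic forms in Gaussian variables *)

(** No conjugation is built in: on coefficients of linear forms in independent standard normals this
    is the pseudo-covariance, and conjugating the second argument gives the covariance. *)
Definition dot (R : realType) (I : finType) (u v : I -> R[i]) : R[i] :=
  \sum_i u i * v i.
Arguments dot {R I} u v.

Section QuadraticForms.
Local Open Scope complex_scope.
Context d (T : measurableType d) (R : realType) (P : probability T R).

Lemma Ereal_sum (J : finType) (c : J -> R) (r : J -> T -> R) :
  (forall j, P.-integrable setT (EFin \o r j)) ->
  Ereal P (fun w => \sum_j c j * r j w) = \sum_j c j * Ereal P (r j).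
Proof.
move=> intr.
have intcr j : P.-integrable setT (fun w => (c j * r j w)%:E).
  exact: (integrableZl measurableT (c j) (intr j)).
rewrite Ereal_Rintegral /Rintegral.
under eq_integral do rewrite -sumEFin.
rewrite integral_sum// -[RHS]/(fine (_%:E)) -sumEFin; congr fine.
apply: eq_bigr => j _; rewrite Ereal_Rintegral -RintegralZl; [|by []|exact: intr].
by rewrite /Rintegral fineK ?integrable_fin_num.
Qed.

Lemma conjcM (x y : R[i]) : conjc (x * y : R[i]) = conjc x * conjc y.
Proof. exact: rmorphM. Qed.

Lemma conjc_sum (J : finType) (F : J -> R[i]) : conjc (\sum_j F j : R[i]) = \sum_j conjc (F j).
Proof. exact: rmorph_sum. Qed.

Lemma ReM_real (z : R[i]) (x : R) : complex.Re (z * x%:C) = complex.Re z * x.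
Proof. by case: z => a b /=; rewrite mulr0 subr0. Qed.

Lemma ImM_real (z : R[i]) (x : R) : complex.Im (z * x%:C) = complex.Im z * x.
Proof. by case: z => a b /=; rewrite mulr0 add0r. Qed.

Lemma Re_sum (J : finType) (F : J -> R[i]) :
  complex.Re (\sum_j F j) = \sum_j complex.Re (F j).
Proof. by apply: (big_morph _ (id1 := 0)) => // -[? ?] [? ?]. Qed.

Lemma Im_sum (J : finType) (F : J -> R[i]) :
  complex.Im (\sum_j F j) = \sum_j complex.Im (F j).
Proof. by apply: (big_morph _ (id1 := 0)) => // -[? ?] [? ?]. Qed.

Lemma sqmodE (z : R[i]) : sqmod z = complex.Re (z * conjc z).
Proof. by case: z => a b /=; rewrite /sqmod /=; ring. Qed.

Lemma Ereal_Re_sum (J : finType) (c : J -> R[i]) (r : J -> T -> R) :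
  (forall j, P.-integrable setT (EFin \o r j)) ->
  Ereal P (fun w => complex.Re (\sum_j c j * (r j w)%:C)) =
  complex.Re (\sum_j c j * (Ereal P (r j))%:C).
Proof.
move=> intr; rewrite Re_sum; under [in RHS]eq_bigr do rewrite ReM_real.
rewrite -Ereal_sum//; congr (Ereal P _); apply/funext => w.
by rewrite Re_sum; apply: eq_bigr => j _; rewrite ReM_real.
Qed.

Lemma Ecplx_sum (J : finType) (c : J -> R[i]) (r : J -> T -> R) :
  (forall j, P.-integrable setT (EFin \o r j)) ->
  Ecplx P (fun w => \sum_j c j * (r j w)%:C) = \sum_j c j * (Ereal P (r j))%:C.
Proof.
move=> intr; apply/eqP; rewrite eq_complex /= Ereal_Re_sum// eqxx /=; apply/eqP.
rewrite Im_sum; under [in RHS]eq_bigr do rewrite ImM_real.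
rewrite -Ereal_sum//; congr (Ereal P _); apply/funext => w.
by rewrite Im_sum; apply: eq_bigr => j _; rewrite ImM_real.
Qed.

Context (I : finType) (g : I -> {RV P >-> R}).
Hypothesis g_indep : mutually_independent g.
Hypothesis g_normal : forall i, std_normal (g i).

Let sum_delta (F : I -> R[i]) i : \sum_j (i == j)%:R * F j = F i.
Proof.
rewrite (bigD1 i)//= eqxx mul1r big1 ?addr0// => j /negPf ji.
by rewrite eq_sym ji mul0r.
Qed.

Let qform (Q : I -> I -> R[i]) w := \sum_i \sum_j Q i j * (g i w * g j w)%:C.

Let Ecplx_qform Q : Ecplx P (qform Q) = \sum_i Q i i.
Proof.
have -> : qform Q =
    (fun w => \sum_(p : I * I) Q p.1 p.2 * (g p.1 w * g p.2 w)%:C).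
  by apply/funext => w; rewrite /qform pair_bigA.
rewrite (Ecplx_sum _ (fun p => Q p.1 p.2) (fun p w => g p.1 w * g p.2 w)).
  rewrite -(pair_bigA _ (fun i j => Q i j * (Ereal P (fun w => g i w * g j w))%:C)).
  apply: eq_bigr => i _ /=; rewrite -[RHS](sum_delta (Q i)).
  apply: eq_bigr => j _.
  by rewrite (@Ereal_mul2 _ _ _ _ _ _ g_indep g_normal) rmorph_nat mulrC.
by move=> p; apply: integrable_mul2.
Qed.

(** The three pairings of Isserlis' formula give, in order, the squared modulus of the trace, the
    squared Frobenius norm, and the pairing of [Q] with its transpose. *)
Let Ereal_sqmod_qform Q :
  Ereal P (fun w => sqmod (qform Q w)) = sqmod (\sum_i Q i i) +
  complex.Re (\sum_i \sum_j Q i j * conjc (Q i j) + \sum_i \sum_j Q i j * conjc (Q j i)).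
Proof.
pose J : finType := ((I * I) * (I * I))%type.
pose c (q : J) := Q q.1.1 q.1.2 * conjc (Q q.2.1 q.2.2).
pose r (q : J) w := g q.1.1 w * g q.1.2 w * g q.2.1 w * g q.2.2 w.
have -> : (fun w => sqmod (qform Q w)) =
    (fun w => complex.Re (\sum_q c q * (r q w)%:C)).
  apply/funext => w; rewrite sqmodE; congr complex.Re.
  rewrite /qform pair_bigA /= conjc_sum big_distrlr /= pair_bigA /=.
  apply: eq_bigr => q _; rewrite /c /r /= conjcM conjc_real !rmorphM /=.
  by ring.
rewrite Ereal_Re_sum; last by move=> q; apply: integrable_mul4.
rewrite [X in X + _]sqmodE -raddfD; congr complex.Re.
rewrite addrA conjc_sum big_distrlr /=.
(* Quadruples are unfolded into four nested sums so that each pair of Kronecker deltas can be summed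
   out. *)
have cE (F : I -> I -> I -> I -> R[i]) :
    \sum_(q : J) F q.1.1 q.1.2 q.2.1 q.2.2 = \sum_i \sum_j \sum_k \sum_l F i j k l.
  rewrite -(pair_bigA _ (fun p q : I * I => F p.1 p.2 q.1 q.2)) [RHS]pair_bigA /=.
  by apply: eq_bigr => p _; rewrite [RHS]pair_bigA.
rewrite /r (eq_bigr (fun q : J => Q q.1.1 q.1.2 * conjc (Q q.2.1 q.2.2) *
    ((q.1.1 == q.1.2)%:R * (q.2.1 == q.2.2)%:R
     + (q.1.1 == q.2.1)%:R * (q.1.2 == q.2.2)%:R
     + (q.1.1 == q.2.2)%:R * (q.1.2 == q.2.1)%:R))); last first.
  by move=> q _; rewrite (@Ereal_mul4 _ _ _ _ _ _ g_indep g_normal)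
    !rmorphD !rmorphM !rmorph_nat.
under eq_bigr do rewrite !mulrDr.
rewrite !big_split /=; congr (_ + _ + _).
- rewrite (cE (fun i j k l => Q i j * conjc (Q k l) * ((i == j)%:R * (k == l)%:R))).
  apply: eq_bigr => i _; rewrite -(sum_delta (fun j => \sum_k Q i j * conjc (Q k k))).
  apply: eq_bigr => j _; rewrite mulr_sumr; apply: eq_bigr => k _.
  rewrite -(sum_delta (fun l => Q i j * conjc (Q k l))) mulr_sumr.
  by apply: eq_bigr => l _; ring.
- rewrite (cE (fun i j k l => Q i j * conjc (Q k l) * ((i == k)%:R * (j == l)%:R))).
  apply: eq_bigr => i _; apply: eq_bigr => j _.
  rewrite -(sum_delta (fun k => Q i j * conjc (Q k j))); apply: eq_bigr => k _.
  rewrite -(sum_delta (fun l => Q i j * conjc (Q k l))) mulr_sumr.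
  by apply: eq_bigr => l _; ring.
- rewrite (cE (fun i j k l => Q i j * conjc (Q k l) * ((i == l)%:R * (j == k)%:R))).
  apply: eq_bigr => i _; apply: eq_bigr => j _.
  rewrite -(sum_delta (fun k => Q i j * conjc (Q k i))); apply: eq_bigr => k _.
  rewrite -(sum_delta (fun l => Q i j * conjc (Q k l))) mulr_sumr.
  by apply: eq_bigr => l _; ring.
Qed.

Definition lin (u : I -> R[i]) w := \sum_i u i * (g i w)%:C.

(** The matrix of the quadratic form is the sum of the outer products of [u m] and [v m]. *)
Let bilinear_qform (N : finType) (u v : N -> I -> R[i]) w :
  \sum_m lin (u m) w * lin (v m) w = qform (fun i j => \sum_m u m i * v m j) w.
Proof.
rewrite /qform /lin; under eq_bigr do rewrite big_distrlr /=.
rewrite exchange_big; apply: eq_bigr => i _; rewrite exchange_big.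
apply: eq_bigr => j _; rewrite mulr_suml; apply: eq_bigr => m _.
by rewrite rmorphM /=; ring.
Qed.

Lemma Ecplx_bilinear (N : finType) (u v : N -> I -> R[i]) :
  Ecplx P (fun w => \sum_m lin (u m) w * lin (v m) w) = \sum_m dot (u m) (v m).
Proof.
under [X in Ecplx P X]funext do rewrite bilinear_qform.
by rewrite Ecplx_qform exchange_big.
Qed.

(** Summing over the Gaussian coordinates first turns products of such matrices into products of
    covariances. *)
Let sum_exchange4 (N : finType) (a b c e : N -> I -> R[i]) :
  \sum_i \sum_j (\sum_m a m i * b m j) * (\sum_m c m i * e m j) =
  \sum_m \sum_n dot (a m) (c n) * dot (b m) (e n).
Proof.
rewrite /dot.
transitivity (\sum_(p : I * I) \sum_(q : N * N)
    a q.1 p.1 * b q.1 p.2 * (c q.2 p.1 * e q.2 p.2)).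
  rewrite pair_bigA; apply: eq_bigr => p _ /=.
  by rewrite big_distrlr pair_bigA.
rewrite exchange_big [RHS]pair_bigA; apply: eq_bigr => q _ /=.
rewrite big_distrlr pair_bigA; apply: eq_bigr => p _ /=; ring.
Qed.

Lemma Ereal_sqmod_bilinear (N : finType) (u v : N -> I -> R[i]) :
  Ereal P (fun w => sqmod (\sum_m lin (u m) w * lin (v m) w)) =
  sqmod (\sum_m dot (u m) (v m)) + complex.Re (
    \sum_m \sum_n dot (u m) (fun i => conjc (u n i)) * dot (v m) (fun i => conjc (v n i)) +
    \sum_m \sum_n dot (u m) (fun i => conjc (v n i)) * dot (v m) (fun i => conjc (u n i))).
Proof.
under [X in Ereal P X]funext do rewrite bilinear_qform.
rewrite Ereal_sqmod_qform; congr (sqmod _ + complex.Re (_ + _)).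
- by rewrite exchange_big.
- rewrite -sum_exchange4; apply: eq_bigr => i _; apply: eq_bigr => j _.
  by congr (_ * _); rewrite conjc_sum; apply: eq_bigr => m _; rewrite conjcM.
- rewrite -sum_exchange4; apply: eq_bigr => i _; apply: eq_bigr => j _.
  congr (_ * _); rewrite conjc_sum; apply: eq_bigr => m _.
  by rewrite conjcM mulrC.
Qed.

End QuadraticForms.
Arguments lin {d T R P I} g u w.

(** * Circular complex Gaussians *)

Section ComplexWick.
Local Open Scope complex_scope.
Context d (T : measurableType d) (R : realType) (P : probability T R)
  (J : finType) (g : J * bool -> {RV P >-> R}) (v : J -> R).
Hypothesis g_indep : mutually_independent g.
Hypothesis g_normal : forall i, std_normal (g i).
Hypothesis v_ge0 : forall j, 0 <= v j.

Definition cnormal j w : R[i] := cgauss (v j) (g (j, true) w) (g (j, false) w).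

Definition cform (a : J -> R[i]) w : R[i] := \sum_j a j * cnormal j w.

(** The covariance of [cform a] and [cform b], the second one conjugated, when coordinate [j] has
    variance [v j]. *)
Definition herm (a b : J -> R[i]) : R[i] :=
  \sum_j a j * conjc (b j) * (v j)%:C.

(** Coefficients of the same form over the real coordinates: [true] marks the real part and [false]
    the imaginary part, as in [cnormal]. *)
Let coef (a : J -> R[i]) (x : J * bool) : R[i] :=
  a x.1 * (Num.sqrt (v x.1 / 2))%:C * (if x.2 then 1 else 'i%C).

Let sum_bool (F : J * bool -> R[i]) : \sum_x F x = \sum_j (F (j, true) + F (j, false)).
Proof.
transitivity (\sum_j \sum_(b : bool) F (j, b)).
  by rewrite pair_bigA; apply: eq_bigr => -[].
by apply: eq_bigr => j _; rewrite big_bool.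
Qed.

Let cformE a w : cform a w = lin g (coef a) w.
Proof.
rewrite /lin sum_bool; apply: eq_bigr => j _.
rewrite /cnormal /coef /= -!mulrA -mulrDr; congr (_ * _).
by apply/eqP; rewrite eq_complex /=; apply/andP; split; apply/eqP; ring.
Qed.

Let conj_cformE a w : conjc (cform a w) = lin g (fun x => conjc (coef a x)) w.
Proof.
rewrite cformE /lin conjc_sum; apply: eq_bigr => x _.
by rewrite conjcM conjc_real.
Qed.

Let sqrt_half j : (Num.sqrt (v j / 2))%:C * (Num.sqrt (v j / 2))%:C * 2 = (v j)%:C.
Proof.
rewrite -rmorphM -expr2 sqr_sqrtr; last by rewrite divr_ge0.
by rewrite -(rmorph_nat (real_complex R)) -rmorphM /= divfK// pnatr_eq0.
Qed.

Let ii : 'i%C * 'i%C = -1 :> R[i]. Proof. by rewrite -expr2 sqr_i. Qed.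
Let conj_i : conjc 'i%C = - 'i%C :> R[i].
Proof. by apply/eqP; rewrite eq_complex /= oppr0 !eqxx. Qed.

Let dot_coef_conj a b : dot (coef a) (fun x => conjc (coef b x)) = herm a b.
Proof.
rewrite /dot sum_bool; apply: eq_bigr => j _.
rewrite /coef /= !conjcM conjc_real conjc1 conj_i -sqrt_half.
transitivity (a j * conjc (b j) * ((Num.sqrt (v j / 2))%:C * (Num.sqrt (v j / 2))%:C
  * (1 - 'i%C * 'i%C))); first by ring.
by rewrite ii opprK; ring.
Qed.

(** Circularity: real and imaginary parts have equal variance, so their contributions cancel through
    1 + i^2 = 0. With a conjugate the factor is 1 - i^2 = 2 instead, which restores the full
    variance. *)
Let dot_coef a b : dot (coef a) (coef b) = 0.
Proof.
rewrite /dot sum_bool big1// => j _; rewrite /coef /=.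
transitivity (a j * b j * ((Num.sqrt (v j / 2))%:C * (Num.sqrt (v j / 2))%:C
  * (1 + 'i%C * 'i%C))); first by ring.
by rewrite ii subrr !mulr0.
Qed.

Let sum_conj_cform (N : finType) (a b : N -> J -> R[i]) w :
  \sum_m conjc (cform (a m) w) * cform (b m) w =
  \sum_m lin g (fun x => conjc (coef (a m) x)) w * lin g (coef (b m)) w.
Proof. by apply: eq_bigr => m _; rewrite conj_cformE cformE. Qed.

Let sum_dot_herm (N : finType) (a b : N -> J -> R[i]) :
  \sum_m dot (fun x => conjc (coef (a m) x)) (coef (b m)) = \sum_m herm (b m) (a m).
Proof.
apply: eq_bigr => m _; rewrite -dot_coef_conj /dot.
by apply: eq_bigr => x _; rewrite mulrC.
Qed.

Lemma Ecplx_herm (N : finType) (a b : N -> J -> R[i]) :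
  Ecplx P (fun w => \sum_m conjc (cform (a m) w) * cform (b m) w) =
  \sum_m herm (b m) (a m).
Proof.
under [X in Ecplx P X]funext do rewrite sum_conj_cform.
rewrite (@Ecplx_bilinear _ _ _ _ _ _ g_indep g_normal _
  (fun m x => conjc (coef (a m) x)) (fun m => coef (b m))).
exact: sum_dot_herm.
Qed.

(** Of the two pairings besides the squared mean, the one matching [a] with [b] across the conjugate
    consists of pseudo-covariances and vanishes. *)
Lemma Ereal_sqmod_herm (N : finType) (a b : N -> J -> R[i]) :
  Ereal P (fun w => sqmod (\sum_m conjc (cform (a m) w) * cform (b m) w)) =
  sqmod (\sum_m herm (b m) (a m)) +
  complex.Re (\sum_m \sum_n conjc (herm (a m) (a n)) * herm (b m) (b n)).
Proof.
under [X in Ereal P X]funext do rewrite sum_conj_cform.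
rewrite (@Ereal_sqmod_bilinear _ _ _ _ _ _ g_indep g_normal _
  (fun m x => conjc (coef (a m) x)) (fun m => coef (b m))) sum_dot_herm.
congr (_ + complex.Re _).
have conj_dot (u w : J * bool -> R[i]) :
    dot (fun x => conjc (u x)) (fun x => conjc (w x)) = conjc (dot u w).
  by rewrite /dot conjc_sum; apply: eq_bigr => x _; rewrite conjcM.
rewrite [X in _ + X]big1 ?addr0 => [|m _]; last first.
  by rewrite big1// => n _; rewrite conj_dot dot_coef conjc0 mul0r.
apply: eq_bigr => m _; apply: eq_bigr => n _.
by rewrite conj_dot !dot_coef_conj.
Qed.

End ComplexWick.
Arguments cnormal {d T R P J} g v j w.
Arguments cform {d T R P J} g v a w.
Arguments herm {R J} v a b.

(** * Mean and power of a combiner output *)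

Section DeltaForms.
Local Open Scope complex_scope.
Context d (T : measurableType d) (R : realType) (P : probability T R)
  (J : finType) (g : J * bool -> {RV P >-> R}) (v : J -> R).
Hypothesis g_indep : mutually_independent g.
Hypothesis g_normal : forall i, std_normal (g i).
Hypothesis v_ge0 : forall j, 0 <= v j.

Let delta (c : R[i]) (x j : J) : R[i] := c * (j == x)%:R.

Let sum_delta c x (F : J -> R[i]) : \sum_j delta c x j * F j = c * F x.
Proof.
rewrite (bigD1 x)//= /delta eqxx mulr1 big1 ?addr0// => j /negPf->.
by rewrite mulr0 mul0r.
Qed.

Let herm_delta c x c' y :
  herm v (delta c x) (delta c' y) = (x == y)%:R * (c * conjc c' * (v x)%:C).
Proof.
rewrite /herm; under eq_bigr do rewrite -mulrA.
rewrite sum_delta /delta conjcM.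
have [->|xy] := eqVneq x y; first by rewrite conjc1 /=; ring.
by rewrite conjc0 /=; ring.
Qed.

Let hermDl a b c : herm v (fun j => a j + b j) c = herm v a c + herm v b c.
Proof. by rewrite /herm -big_split; apply: eq_bigr => j _ /=; ring. Qed.

Let hermDr a b c : herm v c (fun j => a j + b j) = herm v c a + herm v c b.
Proof.
rewrite /herm -big_split; apply: eq_bigr => j _ /=.
by rewrite (_ : conjc (a j + b j) = conjc (a j) + conjc (b j)) ?rmorphD//; ring.
Qed.

Let mul_conj (z : R[i]) : z * conjc z = (sqmod z)%:C.
Proof.
case: z => x y; apply/eqP; rewrite eq_complex /= /sqmod /=.
by apply/andP; split; apply/eqP; ring.
Qed.

(** [N] indexes the antennas. The estimate has coefficients [c] on the channel and [e] on the pilot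
    noise, and the signal has coefficients [f]; [alpha], [s2], [nu] are the variances along [p],
    [q], [r]. The map [r] may equal [p], which covers the device's own signal. *)
Context (N : finType) (p q r : N -> J) (c : R[i]) (e f : N -> R[i])
  (alpha s2 eps kappa nu : R).
Hypothesis p_inj : injective p.
Hypothesis q_inj : injective q.
Hypothesis r_inj : injective r.
Hypothesis pq : forall m n, p m != q n.
Hypothesis v_p : forall m, v (p m) = alpha.
Hypothesis v_q : forall m, v (q m) = s2.
Hypothesis v_r : forall m, v (r m) = nu.
Hypothesis sq_e : forall m, sqmod (e m) = eps.
Hypothesis sq_f : forall m, sqmod (f m) = kappa.

Let a m j := delta c (p m) j + delta (e m) (q m) j.
Let b m j := delta (f m) (r m) j.

(* The combiner output of the theorem: p and q index the channel and pilot noise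
   coordinates that make up the estimate, r those of the signal it is combined
   with (some h_k' or the data noise). *)
Definition combined w : R[i] :=
  \sum_m conjc (c * cnormal g v (p m) w + e m * cnormal g v (q m) w) *
         (f m * cnormal g v (r m) w).

Let combinedE :
  combined = (fun w => \sum_m conjc (cform g v (a m) w) * cform g v (b m) w).
Proof.
apply/funext => w; apply: eq_bigr => m _; rewrite /cform sum_delta; congr (conjc _ * _).
by rewrite /a; under eq_bigr do rewrite mulrDl; rewrite big_split /= !sum_delta.
Qed.

Let herm_b_a m :
  herm v (b m) (a m) =
  (r m == p m)%:R * (f m * conjc c * nu%:C) +
  (r m == q m)%:R * (f m * conjc (e m) * nu%:C).
Proof. by rewrite hermDr !herm_delta v_r. Qed.

(** Different antennas share no coordinate, and channel and pilot noise coordinates are disjoint, so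
    the estimate has covariance a multiple of the identity. *)
Let herm_a m n : herm v (a m) (a n) = (m == n)%:R * (sqmod c * alpha + eps * s2)%:C.
Proof.
rewrite hermDl !hermDr !herm_delta v_p v_q (inj_eq p_inj) (inj_eq q_inj).
rewrite (negPf (pq m n)) (eq_sym (q m)) (negPf (pq n m)) mul_conj.
have [<-|mn] := eqVneq m n; last by rewrite /=; ring.
by rewrite mul_conj sq_e [in RHS]rmorphD !rmorphM /=; ring.
Qed.

Let herm_b m n : herm v (b m) (b n) = (m == n)%:R * (kappa * nu)%:C.
Proof.
rewrite herm_delta (inj_eq r_inj) v_r.
have [<-|mn] := eqVneq m n; last by rewrite !mul0r.
by rewrite mul_conj sq_f rmorphM.
Qed.

(** The coincidence tests let one formula serve all signals: [r] equal to [p] gives the desired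
    signal, [r] disjoint from [p] and [q] gives mean zero. *)
Lemma Ecplx_delta_forms : Ecplx P combined =
  \sum_m ((r m == p m)%:R * (f m * conjc c * nu%:C) +
          (r m == q m)%:R * (f m * conjc (e m) * nu%:C)).
Proof.
rewrite combinedE (@Ecplx_herm _ _ _ _ _ _ _ g_indep g_normal v_ge0).
by apply: eq_bigr => m _; exact: herm_b_a.
Qed.

(** Both covariances are multiples of the identity, so the double sum reduces to [#|N|] equal
    diagonal terms. *)
Lemma Ereal_sqmod_delta_forms : Ereal P (fun w => sqmod (combined w)) =
  sqmod (Ecplx P combined) + #|N|%:R * (sqmod c * alpha + eps * s2) * (kappa * nu).
Proof.
rewrite Ecplx_delta_forms.
rewrite combinedE (@Ereal_sqmod_herm _ _ _ _ _ _ _ g_indep g_normal v_ge0).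
under eq_bigr do rewrite herm_b_a.
congr (_ + _).
set G := sqmod c * alpha + _.
transitivity (complex.Re (\sum_(m : N) (G * (kappa * nu))%:C)).
  congr complex.Re; apply: eq_bigr => m _; rewrite (bigD1 m)//= big1.
    by rewrite herm_a herm_b eqxx !mul1r conjc_real addr0 -rmorphM.
  by move=> n /negPf nm; rewrite herm_b eq_sym nm mul0r mulr0.
by rewrite Re_sum /= sumr_const -mulrA mulr_natl.
Qed.

End DeltaForms.
Arguments combined {d T R P J} g v {N} p q r c e f w.

(** * The uplink rate under maximum ratio combining *)

Theorem theorem1 (d : measure_display) (T : measurableType d) (R : realType)
  (P : probability T R) (M K TT TU : nat) (g : gidx K M -> {RV P >-> R})
  (Phi : R[i]) (rho sigma2 : R) (D : 'M[R[i]]_M) (beta pp pd : 'I_K -> R) :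
  (0 < M)%N -> (0 < K)%N -> (0 < TT)%N ->
  Phi != 0 -> 0 < rho -> 0 < sigma2 ->
  (forall i j : 'I_M, i != j -> D i j = 0) ->
  (forall i : 'I_M, sqmod (D i i) = 1) ->
  (forall k, 0 < beta k) -> (forall k, 0 < pp k) -> (forall k, 0 <= pd k) ->
  (* all real Gaussian coordinates of channels, pilot noise and data noise
     are mutually independent N(0,1) *)
  mutually_independent g -> (forall i, std_normal (g i)) ->
  let tau : R := K%:R in
  let phi2 := sqmod Phi in
  (* h_k ~ CN(0, beta_k I), z_k ~ CN(0, sigma2 I), n ~ CN(0, sigma2 I) *)
  let h k w := chan g beta k w in
  let z k w := pnoise g sigma2 k w in
  let n w := dnoise g sigma2 w in
  (* MMSE channel estimate *)
  let hhat k w :=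
    toC (rho * beta k * tau * pp k * phi2 /
           (rho * beta k * tau * pp k * phi2 + sigma2)) *: h k w
    + (toC (Num.sqrt (rho * tau * pp k) * beta k /
           (rho * beta k * tau * pp k * phi2 + sigma2)) * conjc Phi)
        *: (hermT D *m z k w) in
  (* maximum ratio combining *)
  let c k w := Phi *: (D *m hhat k w) in
  forall k : 'I_K,
  let Ds := Ecplx P (fun w =>
              toC (Num.sqrt (rho * pd k)) * Phi * cinner (c k w) (D *m h k w)) in
  let Ls2 := Ereal P (fun w => sqmod
              (toC (Num.sqrt (rho * pd k)) * Phi * cinner (c k w) (D *m h k w)))
             - sqmod Ds in
  let UI2 k' := Ereal P (fun w => sqmod
              (toC (Num.sqrt (rho * pd k')) * Phi * cinner (c k w) (D *m h k' w))) in
  let N2 := Ereal P (fun w => sqmod (cinner (c k w) (n w))) in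
  let RU := TU%:R / TT%:R *
      log2 (1 + sqmod Ds / (Ls2 + \sum_(k' < K | k' != k) UI2 k' + N2)) in
  let SINR := M%:R * pd k * rho * tau * pp k * beta k ^+ 2 * phi2 /
      ((\sum_(k' < K) pd k' * beta k' + sigma2 / (phi2 * rho)) *
       (rho * tau * pp k * beta k * phi2 + sigma2)) in
  TU%:R / TT%:R * log2 (1 + SINR) <= RU.
Proof.
move=> M0 K0 T0 Phi0 rho0 s20 Ddiag Dunit beta0 pp0 pd0 g_indep g_normal.
move=> tau phi2 h z n hhat c k; cbv zeta.
(* With this [J], [gidx K M] is [J * bool]: one complex coordinate per element of [J], of variance
   [v]. *)
pose J : finType := (('I_K * 'I_M) + ('I_K * 'I_M) + 'I_M)%type.
pose v (j : J) : R := match j with inl (inl (k, _)) => beta k | _ => sigma2 end.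
have v0 j : 0 <= v j.
  by case: j => [[[k' m]|[k' m]]|m]; rewrite /v ltW.
(* [S] is the denominator of the estimator, [ca] its gain on the channel and [cb] its gain on the
   rotated pilot noise. *)
pose S := rho * beta k * tau * pp k * phi2 + sigma2.
pose ca := rho * beta k * tau * pp k * phi2 / S.
pose cb := toC (Num.sqrt (rho * tau * pp k) * beta k / S) * conjc Phi.
pose p (m : 'I_M) : J := inl (inl (k, m)).
pose q (m : 'I_M) : J := inl (inr (k, m)).
pose e m : R[i] := cb * conjc (D m m).
have Dmul (x : 'cV[R[i]]_M) i : (D *m x) i 0 = D i i * x i 0.
  rewrite mxE (bigD1 i)//= big1 ?addr0// => j ji.
  by rewrite Ddiag ?mul0r// eq_sym.
have DHmul (x : 'cV[R[i]]_M) i : (hermT D *m x) i 0 = conjc (D i i) * x i 0.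
  rewrite mxE (bigD1 i)//= big1 ?addr0 ?mxE// => j ji.
  by rewrite mxE Ddiag// conjc0 mul0r.
have hhatE w m : hhat k w m 0 =
    toC ca * cnormal g v (p m) w + e m * cnormal g v (q m) w.
  rewrite /hhat mxE; congr (_ + _); first by rewrite !mxE.
  by rewrite mxE DHmul !mxE mulrA.
have cinnerE w x : cinner (c k w) x =
    \sum_m conjc (toC ca * cnormal g v (p m) w + e m * cnormal g v (q m) w) *
      (conjc Phi * conjc (D m m) * x m 0).
  rewrite /cinner mxE; apply: eq_bigr => m _.
  by rewrite mxE /c mxE Dmul hhatE !conjcM; ring.
have DD m : conjc (D m m) * D m m = 1.
  rewrite mulrC; have := Dunit m; case: (D m m) => x y /= xy.
  apply/eqP; rewrite eq_complex /= -xy /sqmod /=.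
  by apply/andP; split; apply/eqP; ring.
(* [Phi] enters both through the combiner and through the received signal, hence the square of
   [phi2]. *)
pose kap k' : R := rho * pd k' * phi2 ^+ 2.
(* The variance of an entry of the estimate. *)
pose gam := sqmod (toC ca) * beta k + sqmod cb * sigma2.
have sqmodM (x y : R[i]) : sqmod (x * y) = sqmod x * sqmod y.
  by case: x => x1 x2; case: y => y1 y2; rewrite /sqmod /=; ring.
have sqmodJ (x : R[i]) : sqmod (conjc x) = sqmod x.
  by case: x => x1 x2; rewrite /sqmod /= sqrrN.
have sqmodC (x : R) : sqmod (toC x) = x ^+ 2.
  by rewrite /sqmod /= expr0n /= addr0.
have sq_e m : sqmod (e m) = sqmod cb by rewrite sqmodM sqmodJ Dunit mulr1.
have p_inj : injective p by move=> m m' [].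
have q_inj : injective q by move=> m m' [].
(* The entries of [D] are absent here: those of the combiner cancel those of the channel by [DD]. *)
pose f k' (_ : 'I_M) : R[i] := toC (Num.sqrt (rho * pd k')) * (Phi * conjc Phi).
have sq_f k' m : sqmod (f k' m) = kap k'.
  rewrite /f !sqmodM sqmodJ sqmodC sqr_sqrtr ?mulr_ge0 ?(ltW rho0)//.
pose r k' (m : 'I_M) : J := inl (inl (k', m)).
have r_inj k' : injective (r k') by move=> m m' [].
have signalE k' : (fun w => toC (Num.sqrt (rho * pd k')) * Phi *
      cinner (c k w) (D *m h k' w)) =
    combined g v p q (r k') (toC ca) e (f k').
  apply/funext => w; rewrite cinnerE mulr_sumr; apply: eq_bigr => m _.
  rewrite Dmul !mxE -/(cnormal g v (r k' m) w) /f.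
  rewrite -[in RHS](mul1r (cnormal g v (r k' m) w)) -(DD m); ring.
have signal_sqE k' : (fun w => sqmod (toC (Num.sqrt (rho * pd k')) * Phi *
      cinner (c k w) (D *m h k' w))) =
    (fun w => sqmod (combined g v p q (r k') (toC ca) e (f k') w)).
  by apply/funext => w; exact: (congr1 (fun F => sqmod (F w)) (signalE k')).
pose fn (m : 'I_M) : R[i] := conjc Phi * conjc (D m m).
have sq_fn m : sqmod (fn m) = phi2 by rewrite sqmodM !sqmodJ Dunit mulr1.
pose rn (m : 'I_M) : J := inr m.
have rn_inj : injective rn by move=> m m' [].
have noise_sqE : (fun w => sqmod (cinner (c k w) (n w))) =
    (fun w => sqmod (combined g v p q rn (toC ca) e fn w)).
  apply/funext => w; rewrite cinnerE; congr sqmod; apply: eq_bigr => m _.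
  by rewrite !mxE.
(* One formula for desired signal, interference and noise: squared mean plus M [gam] times the
   variance of an entry of the combined signal. *)
have power c' (rr : 'I_M -> J) ff kappa nu :
    injective rr -> (forall m, v (rr m) = nu) -> (forall m, sqmod (ff m) = kappa) ->
    sqmod (Ecplx P (combined g v p q rr (toC ca) e ff)) = c' ->
    Ereal P (fun w => sqmod (combined g v p q rr (toC ca) e ff w)) =
    c' + M%:R * gam * (kappa * nu).
  move=> rr_inj vrr sq_ff <-.
  by rewrite (@Ereal_sqmod_delta_forms _ _ _ _ _ g v g_indep g_normal v0 _ p q rr
    (toC ca) e ff (beta k) sigma2 (sqmod cb) kappa nu)// card_ord.
have mean := Ecplx_delta_forms _ _ _ _ _ g v g_indep g_normal v0 _ p q.
have natC : M%:R = toC M%:R :> R[i] by exact: esym (rmorph_nat (real_complex R) M).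
have mean_k : sqmod (Ecplx P (combined g v p q (r k) (toC ca) e (f k))) =
    M%:R ^+ 2 * kap k * ca ^+ 2 * beta k ^+ 2.
  rewrite (mean _ _ _ _ (beta k))//.
  (* [f k] is constant over the antennas, so index 0, available by [M0], stands for all of them. *)
  rewrite (eq_bigr (fun=> f k (Ordinal M0) * toC ca * toC (beta k))); last first.
    move=> m _; have -> : conjc (toC ca) = toC ca by rewrite /toC /= oppr0.
    by rewrite eqxx (_ : (r k m == q m) = false)// mul1r mul0r addr0.
  rewrite sumr_const card_ord -[X in sqmod X]mulr_natl natC 3!sqmodM.
  by rewrite (sq_f k) !sqmodC; ring.
have mean_other k' : k' != k ->
    sqmod (Ecplx P (combined g v p q (r k') (toC ca) e (f k'))) = 0.
  move=> kk'; rewrite (mean _ _ _ _ (beta k'))// big1 => [|m _].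
    by rewrite /sqmod /= expr0n addr0.
  have /negPf-> : r k' m != p m by apply: contra kk' => /eqP[->].
  have /negPf-> : r k' m != q m by [].
  by rewrite !mul0r addr0.
have mean_noise : sqmod (Ecplx P (combined g v p q rn (toC ca) e fn)) = 0.
  rewrite (mean _ _ _ _ sigma2)// big1 => [|m _]; last by rewrite /= !mul0r addr0.
  by rewrite /sqmod /= expr0n addr0.
rewrite signalE (signal_sqE k) (power _ (r k) (f k) (kap k) (beta k) _ _ _ mean_k)//.
rewrite mean_k.
have -> : \sum_(k' < K | k' != k) Ereal P (fun w => sqmod
      (toC (Num.sqrt (rho * pd k')) * Phi * cinner (c k w) (D *m h k' w))) =
    M%:R * gam * rho * phi2 ^+ 2 * \sum_(k' < K | k' != k) pd k' * beta k'.
  rewrite mulr_sumr; apply: eq_bigr => k' kk'; rewrite (signal_sqE k').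
  rewrite (power _ (r k') (f k') (kap k') (beta k') _ _ _ (mean_other _ kk'))// add0r /kap.
  ring.
rewrite noise_sqE (power _ rn fn phi2 sigma2 _ _ _ mean_noise)// add0r.
have phi20 : 0 < phi2.
  rewrite lt0r addr_ge0 ?sqr_ge0// andbT; apply: contra Phi0.
  rewrite /phi2 /sqmod paddr_eq0 ?sqr_ge0// !sqrf_eq0 => /andP[/eqP re0 /eqP im0].
  by rewrite eq_complex re0 im0 !eqxx.
have tau0 : 0 < tau by rewrite ltr0n.
have S0 : 0 < S by rewrite /S addr_gt0// !mulr_gt0.
(* Orthogonality of the MMSE estimate: the channel and noise parts of the variance add up to a
   multiple of [S], which cancels one of the two factors 1/[S]. *)
have gamE : gam = ca * beta k.
  rewrite /gam sqmodC /cb sqmodM sqmodC sqmodJ -/phi2 !expr_div_n !exprMn.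
  rewrite sqr_sqrtr ?mulr_ge0 ?ltW//.
  rewrite /ca; move: (lt0r_neq0 S0); rewrite /S => S_neq0; field.
  exact: S_neq0.
have sum_ge0 : 0 <= \sum_(k' < K) pd k' * beta k'.
  by apply: sumr_ge0 => k' _; rewrite mulr_ge0// ltW.
(* The variance of the own signal supplies the missing term [k], so the denominator of the rate
   involves the full sum. *)
have -> : \sum_(k' < K | k' != k) pd k' * beta k' =
    \sum_(k' < K) pd k' * beta k' - pd k * beta k.
  by rewrite [in RHS](bigD1 k)//= addrAC subrr add0r.
set Sg := \sum_(k' < K) _ in sum_ge0 *.
have ca0 : 0 < ca by rewrite divr_gt0// !mulr_gt0.
have MR0 : 0 < M%:R :> R by rewrite ltr0n.
rewrite gamE.
set lhs := log2 _; set rhs := log2 _.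
suff -> : lhs = rhs by [].
rewrite /lhs /rhs; congr (log2 (1 + _)); rewrite /kap.
(* Since [ca] times [S] is the numerator of the gain, the factor [S] will cancel against the one in
   the denominator of the SINR. *)
have -> : M%:R * pd k * rho * tau * pp k * beta k ^+ 2 * phi2 = M%:R * pd k * (ca * S) * beta k.
  by rewrite /ca divfK ?gt_eqF//; ring.
have -> : rho * tau * pp k * beta k * phi2 + sigma2 = S by rewrite /S; ring.
have b0 := beta0 k.
have D0 : 0 < Sg * (phi2 * rho) + sigma2.
  by rewrite ltr_wpDl// !mulr_ge0// ltW.
(* The total interference and noise power, factored so that its positivity is visible. *)
have den0 : 0 < M%:R * ca * beta k * phi2 * (Sg * (phi2 * rho) + sigma2).
  by do 4 apply: mulr_gt0 => //.
field; apply/and5P; split; rewrite gt_eqF//.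
by move: den0; congr (0 < _); ring.
Qed.
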